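(* For every constant number $n\ge 2$ of agents and every constant number $k\ge 1$ of queries per agent, the best possible EFX approximation is $\Theta\big(m^{-1/(2k-1)}\big)$. That is, there exist constants $c,C>0$ and $m_0$ (depending only on $n$ and $k$) such that for all $m\ge m_0$: (i) there is a $k$-query algorithm that computes a $\frac{c}{m^{1/(2k-1)}}$-EFX allocation for every instance with $n$ agents and $m$ goods; and (ii) for every $\alpha\in[0,1]$ with $\alpha>\frac{C}{m^{1/(2k-1)}}$, no $k$-query algorithm computes an $\alpha$-EFX allocation for every instance with $n$ agents and $m$ goods.
   Context: There is a set $N=\{1,\dots,n\}$ of $n\ge 2$ agents and a set $G$ of $m\ge n$ goods. Each agent $i$ has a valuation function $v_i:G\to\mathbb{R}_{\ge 0}$, extended additively to bundles: $v_i(X)=\sum_{g\in X}v_i(g)$ for $X\subseteq G$. An allocation is a tuple $(X_i)_{i\in N}$ of pairwise disjoint (possibly empty) bundles with $\bigcup_{i}X_i=G$. For $\alpha\in[0,1]$, an allocation is $\alpha$-EFX if for all agents $i\ne j$ with $X_j\neq\varnothing$ and every $g\in X_j$, $v_i(X_i)\ge\alpha\cdot v_i(X_j\setminus\{g\})$. A ranking (strict linear order) $\succ_i$ of $G$ is consistent with $v_i$ if $g\succ_i g'$ implies $v_i(g)\ge v_i(g')$. An instance consists of valuations together with rankings consistent with them. A $k$-query algorithm is a deterministic algorithm that receives as input the rankings $(\succ_i)_{i\in N}$, may (adaptively) make at most $k$ value queries per agent, where a value query names an agent $i$ and a good $g$ and returns $v_i(g)$, and finally outputs an allocation. *)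

(* Defs.v *)
From mathcomp Require Import all_boot all_order all_algebra.
From mathcomp Require Import reals exp.
Set Implicit Arguments.
Unset Strict Implicit.
Unset Printing Implicit Defensive.
Import Order.TTheory GRing.Theory Num.Theory.
Local Open Scope ring_scope.

(* Agents are 'I_n and goods are 'I_m throughout. *)

Definition valuations (R : realType) (n m : nat) : Type := 'I_n -> 'I_m -> R.

(* [rk i g g'] reads "agent i ranks g strictly above g'". *)
Definition rankings (n m : nat) : Type := 'I_n -> rel 'I_m.

Definition bundle_value (R : realType) (m : nat) (vi : 'I_m -> R)
    (X : {set 'I_m}) : R :=
  \sum_(g in X) vi g.

Definition strict_linear_order (T : eqType) (r : rel T) : Prop :=
  [/\ irreflexive r, transitive r & forall x y, x != y -> r x y || r y x].

Definition consistent (R : realType) (m : nat) (r : rel 'I_m)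
    (vi : 'I_m -> R) : Prop :=
  forall g g', r g g' -> vi g' <= vi g.

Definition is_instance (R : realType) (n m : nat) (v : valuations R n m)
    (rk : rankings n m) : Prop :=
  forall i, [/\ forall g, 0 <= v i g, strict_linear_order (rk i)
              & consistent (rk i) (v i)].

Definition is_allocation (n m : nat) (X : 'I_n -> {set 'I_m}) : Prop :=
  (forall i j, i != j -> [disjoint X i & X j]) /\
  \bigcup_(i < n) X i = [set: 'I_m].

Definition is_EFX (R : realType) (n m : nat) (alpha : R) (v : valuations R n m)
    (X : 'I_n -> {set 'I_m}) : Prop :=
  forall i j, i != j -> X j != set0 -> forall g, g \in X j ->
    alpha * bundle_value (v i) (X j :\ g) <= bundle_value (v i) (X i).

(* A deterministic adaptive strategy as a decision tree: either stop and
   return bundles, or ask for the value of good g for agent i and continue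
   according to the answer. *)
Inductive strategy (R : realType) (n m : nat) : Type :=
| Output of 'I_n -> {set 'I_m}
| Query (i : 'I_n) (g : 'I_m) of R -> strategy R n m.

Fixpoint run (R : realType) (n m : nat) (v : valuations R n m)
    (s : strategy R n m) : 'I_n -> {set 'I_m} :=
  match s with
  | Output X => X
  | Query i g next => run v (next (v i g))
  end.

(* Number of queries to agent a made while executing s on v; a repeated query
   counts again. *)
Fixpoint num_queries (R : realType) (n m : nat) (v : valuations R n m)
    (s : strategy R n m) (a : 'I_n) : nat :=
  match s with
  | Output _ => 0%N
  | Query i g next => ((i == a) + num_queries v (next (v i g)) a)%N
  end.

Definition algorithm (R : realType) (n m : nat) : Type :=
  rankings n m -> strategy R n m.

Definition is_query_algorithm (R : realType) (n m k : nat)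
    (A : algorithm R n m) : Prop :=
  forall v rk, is_instance v rk ->
    is_allocation (run v (A rk)) /\
    forall a, (num_queries v (A rk) a <= k)%N.

Definition computes_EFX (R : realType) (n m : nat) (alpha : R)
    (A : algorithm R n m) : Prop :=
  forall v rk, is_instance v rk -> is_EFX alpha v (run v (A rk)).

(* Main.v *)
(** Algorithm.  Fix T of order m^(1/(2k-1)).  Every agent except [i0] is asked,
in turn, for the values of the goods that it ranks 1, T, T^3, ..., T^(2k-3)
among the goods still available.  If its top good is worth more than T^(2j)
times the good ranked T^(2j-1), for all j with 1 <= j < k, then this top good is
worth a 1/(kT) fraction of everything available, and the agent leaves with it.
Otherwise every available good is worth at most 2T times all the others, even
after the loss of any few goods, and the agent waits.  Finally [i0] and the
waiting agents share the remaining goods by round robin with [i0] first.  The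
i-th agent of a queue of r gets 1/r of everything except at most i - 1 goods,
which is enough for a waiting agent, and for [i0] there is no exception.

Impossibility.  All agents rank the goods alike: n - 2 goods of huge value M,
then a pivot of value 1, and the p-th good from the pivot on is worth 1/(Tp)
for p >= 2.  The allocation returned on this instance must remain EFX for every
valuation that agrees with it on the queried goods.  If the pivot shares a
bundle, let b be another agent without huge good: either the pivot was not
queried for b and can be raised to M, or the unqueried goods of b can be lowered
until everything after the pivot is worth at most k/T.  If the pivot is alone,
the unqueried goods of its owner can be raised: one of the k intervals
(T^(2j-1), T^(2j+1)] contains no query but possibly the first one, and its goods
become worth of order T times the pivot. *)
Require Import Defs.
From mathcomp Require Import all_boot all_order all_algebra.
From mathcomp Require Import reals exp.
From mathcomp Require Import zify lra.
Import Order.TTheory GRing.Theory Num.Theory.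
Local Open Scope ring_scope.

(** * Round robin *)

Definition by_rank {m : nat} (r : rel 'I_m) (S : {set 'I_m}) : seq 'I_m :=
  sort (fun x y => (x == y) || r x y) (enum S).

Lemma mem_by_rank {m : nat} (r : rel 'I_m) (S : {set 'I_m}) (g : 'I_m) :
  (g \in by_rank r S) = (g \in S).
Proof. by rewrite mem_sort mem_enum. Qed.

Lemma by_rank_uniq {m : nat} (r : rel 'I_m) (S : {set 'I_m}) :
  uniq (by_rank r S).
Proof. by rewrite sort_uniq enum_uniq. Qed.

Lemma sum_by_rank {R : realType} {m : nat} (r : rel 'I_m) (S : {set 'I_m})
    (w : 'I_m -> R) :
  \sum_(x <- [seq w g | g <- by_rank r S]) x = \sum_(g in S) w g.
Proof.
by rewrite big_map (perm_big (enum S)) ?big_enum //= perm_sort.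
Qed.

Lemma values_sorted {R : realType} {m : nat} (r : rel 'I_m) (w : 'I_m -> R)
    (S : {set 'I_m}) :
  strict_linear_order r -> consistent r w ->
  sorted (fun x y : R => y <= x) [seq w g | g <- by_rank r S].
Proof.
move=> [_ _ tot] cons; rewrite sorted_map.
apply: (@sub_sorted _ (fun x y => (x == y) || r x y)).
  by move=> x y /orP[/eqP -> //=|/cons].
apply: sort_sorted => x y; case: (eqVneq x y) => //= xy; exact: tot.
Qed.

Lemma values_antitone {R : realType} {m : nat} (r : rel 'I_m) (w : 'I_m -> R)
    (S : {set 'I_m}) (i j : nat) :
  strict_linear_order r -> consistent r w -> (forall g, 0 <= w g) ->
  (i <= j)%N ->
  [seq w g | g <- by_rank r S]`_j <= [seq w g | g <- by_rank r S]`_i.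
Proof.
move=> lin cons w0 ij; set u := [seq w g | g <- by_rank r S].
have u0 l : 0 <= u`_l.
  case: (ltnP l (size u)) => [/(mem_nth 0)/mapP[g _ ->]//|].
  by move/(nth_default 0) ->.
case: (ltnP j (size u)) => [ju|/(nth_default 0) -> //].
apply: (@sorted_leq_nth _ (fun x y : R => y <= x)) => //.
- by move=> y x z xy yz; exact: le_trans yz xy.
- exact: values_sorted.
- by rewrite inE; exact: leq_ltn_trans ju.
Qed.

Lemma top_max {R : realType} {m : nat} (r : rel 'I_m) (w : 'I_m -> R)
    (S : {set 'I_m}) (t : 'I_m) (l : seq 'I_m) :
  strict_linear_order r -> consistent r w -> (forall g, 0 <= w g) ->
  by_rank r S = t :: l -> forall g, g \in S -> w g <= w t.
Proof.
move=> lin cons w0 eqS g; rewrite -(mem_by_rank r) => gS.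
have := values_antitone r w S 0 (index g (by_rank r S)) lin cons w0 (leq0n _).
by rewrite /= (nth_map t) ?index_mem // nth_index // eqS.
Qed.

Lemma sum_setD_ub {R : realType} {m : nat} (w : 'I_m -> R) (S D : {set 'I_m})
    (t : R) :
  0 <= t -> (forall g, g \in S -> w g <= t) ->
  \sum_(g in S) w g <= #|D|%:R * t + \sum_(g in S :\: D) w g.
Proof.
move=> t0 wt; rewrite (big_setID D) /= lerD2r.
apply: (@le_trans _ _ (\sum_(g in S :&: D) t)).
  by apply: ler_sum => g; rewrite inE => /andP[/wt].
rewrite sumr_const -[leLHS]mulr_natl ler_wpM2r // ler_nat.
by apply: subset_leq_card; apply: subsetIr.
Qed.

Lemma sum_subset_le {R : realType} {m : nat} (w : 'I_m -> R)
    (A B : {set 'I_m}) :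
  (forall g, 0 <= w g) -> A \subset B ->
  \sum_(g in A) w g <= \sum_(g in B) w g.
Proof.
move=> w0 AB; rewrite [leRHS](big_setID A) /= (setIidPr AB) lerDl.
exact: sumr_ge0.
Qed.

(** The result names an owner for each good. The head of the queue takes its top good and moves to
    the back, so [#|S|] units of fuel suffice. *)
Fixpoint round_robin {n m : nat} (rk : rankings n m) (i0 : 'I_n) (fuel : nat)
    (q : seq 'I_n) (S : {set 'I_m}) : 'I_m -> 'I_n :=
  if fuel is f.+1 then
    if by_rank (rk (head i0 q)) S is t :: _ then
      fun g => if g == t then head i0 q
               else round_robin rk i0 f (rot 1 q) (S :\ t) g
    else fun=> head i0 q
  else fun=> head i0 q.

Lemma round_robin_in {n m : nat} (rk : rankings n m) (i0 : 'I_n) (fuel : nat)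
    (q : seq 'I_n) (S : {set 'I_m}) (g : 'I_m) :
  (0 < size q)%N -> round_robin rk i0 fuel q S g \in q.
Proof.
have hq q' : (0 < size q')%N -> head i0 q' \in q'.
  by case: q' => //= b q' _; rewrite inE eqxx.
elim: fuel q S => [|f IH] q S q0 /=; first exact: hq.
case: (by_rank _ _) => [|t l]; first exact: hq.
case: eqP => _; first exact: hq.
by rewrite -(mem_rot 1) IH // size_rot.
Qed.

(* If [i] picks first, its pick [t] is worth at least each of the at most
   [size q - 1] goods that are lost before its next pick. *)
Lemma round_robin_share {R : realType} {n m : nat} (rk : rankings n m)
    (i0 : 'I_n) (fuel : nat) (q : seq 'I_n) (S : {set 'I_m}) (i : 'I_n)
    (w : 'I_m -> R) :
  (#|S| <= fuel)%N -> uniq q -> i \in q ->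
  strict_linear_order (rk i) -> consistent (rk i) w -> (forall g, 0 <= w g) ->
  exists2 D : {set 'I_m}, (#|D| <= index i q)%N &
    \sum_(g in S :\: D) w g <=
      (size q)%:R *
      \sum_(g in S | round_robin rk i0 fuel q S g == i) w g.
Proof.
move=> Sf uq iq lin cons w0.
elim: fuel q S Sf uq iq => [|f IH] q S Sf uq iq.
  move: Sf; rewrite leqn0 cards_eq0 => /eqP ->.
  exists set0; rewrite ?cards0 // set0D big_set0 mulr_ge0 // sumr_ge0 //.
have sz : (0 < size q)%N by case: q iq {uq}.
rewrite /=; case eqS: (by_rank _ _) => [|t l].
  have -> : S = set0.
    by apply/setP => g; rewrite -(mem_by_rank (rk (head i0 q))) eqS !inE.
  exists set0; rewrite ?cards0 // set0D big_set0 mulr_ge0 // sumr_ge0 //.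
have tS : t \in S by rewrite -(mem_by_rank (rk (head i0 q))) eqS inE eqxx.
have [||| D Dc Dle] := IH (rot 1 q) (S :\ t).
- by move: Sf; rewrite (cardsD1 t) tS.
- by rewrite rot_uniq.
- by rewrite mem_rot.
have split_own : \sum_(g in S | (if g == t then head i0 q
    else round_robin rk i0 f (rot 1 q) (S :\ t) g) == i) w g =
    (if head i0 q == i then w t else 0) +
    \sum_(g in S :\ t | round_robin rk i0 f (rot 1 q) (S :\ t) g == i) w g.
  rewrite (bigID (pred1 t)) /=; congr (_ + _).
    rewrite (eq_bigl (fun g => (head i0 q == i) && (g == t))).
      by case: ifP => _; rewrite ?big_pred1_eq //= big_pred0.
    move=> g /=; have [->|_] := eqVneq g t; rewrite ?andbF // tS !andbT //.
  apply: eq_bigl => g /=; rewrite !inE.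
  by have [->|_] := eqVneq g t; rewrite ?andbF ?andbT.
rewrite split_own {split_own}.
case: q sz uq iq eqS Dc Dle => //= a q _ /andP[aq uq].
rewrite rot1_cons size_rcons.
rewrite inE => iaq eqS Dc Dle.
case: (eqVneq a i) iaq => [ai _|ai iaq].
  (* After its pick, [i] is last in the rotated queue, so the induction hypothesis loses at most
     [size q] goods. The pick [t] pays for these and for itself, which accounts for the factor
     [size q + 1]. *)
  subst a; exists set0; first by rewrite cards0.
  rewrite setD0 (big_setD1 t) //= mulrDr.
  have top := top_max _ _ _ _ _ lin cons w0 eqS.
  have ub : \sum_(g in S :\ t) w g <=
      #|D|%:R * w t + \sum_(g in S :\ t :\: D) w g.
    by apply: sum_setD_ub => // g; rewrite !inE => /andP[_ /top].
  have Dq : #|D|%:R * w t <= (size q)%:R * w t.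
    rewrite ler_wpM2r // ler_nat (leq_trans Dc) //.
    by rewrite -cats1 index_cat (negPf aq) /= eqxx addn0.
  rewrite -natr1 mulrDl mul1r; rewrite -natr1 in Dle; lra.
rewrite /= in iaq.
(* Another agent's pick is one more lost good, while [i] moves one place forward in the queue. *)
exists (t |: D).
  rewrite -cats1 index_cat iaq in Dc; rewrite cardsU1.
  by case: (t \in D) => /=; lia.
by rewrite add0r -setDDl.
Qed.

(** * The query algorithm *)

Fixpoint ask {R : realType} {n m : nat} (i : 'I_n) (gs : seq 'I_m)
    (next : seq R -> strategy R n m) : strategy R n m :=
  if gs is g :: gs' then Query i g (fun x => ask i gs' (fun l => next (x :: l)))
  else next [::].

Lemma run_ask {R : realType} {n m : nat} (v : valuations R n m) (i : 'I_n)
    (gs : seq 'I_m) (next : seq R -> strategy R n m) :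
  run v (ask i gs next) = run v (next [seq v i g | g <- gs]).
Proof. by elim: gs next => //= g gs IH next; rewrite IH. Qed.

Lemma num_queries_ask {R : realType} {n m : nat} (v : valuations R n m)
    (i a : 'I_n) (gs : seq 'I_m) (next : seq R -> strategy R n m) :
  num_queries v (ask i gs next) a =
  ((i == a) * size gs + num_queries v (next [seq v i g | g <- gs]) a)%N.
Proof.
elim: gs next => [|g gs IH] next /=; first by rewrite muln0.
by rewrite IH mulnS addnA.
Qed.

(** Cut the positions at T, T^3, T^5, and so on. The first block has T terms; each later block has
    fewer than T^(2j+1) terms, all at most [u 0] / T^(2j). Hence each of the k blocks contributes at
    most T times [u 0]. *)
Lemma antitone_sum_ub {R : realType} (u : nat -> R) (T k : nat) :
  (0 < T)%N -> (forall p, 0 <= u p) ->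
  (forall p q, (p <= q)%N -> u q <= u p) ->
  (forall j, (0 < j < k)%N ->
    (T ^ (2 * j))%:R * u (T ^ (2 * j - 1)).-1 <= u 0) ->
  (0 < k)%N ->
  \sum_(0 <= p < T ^ (2 * k - 1)) u p <= (k * T)%:R * u 0.
Proof.
move=> T0 u0 anti; elim: k => // k IH hyp _.
case: k IH hyp => [|k] IH hyp.
  rewrite mul1n; apply: (@le_trans _ _ (\sum_(0 <= p < T) u 0)).
    by apply: ler_sum_nat => p _; exact: anti.
  by rewrite sumr_const_nat subn0 mulr_natl.
have expT j : (0 < T ^ j)%N by rewrite expn_gt0 T0.
rewrite (big_cat_nat (n := T ^ (2 * k.+1 - 1))) //=; last first.
  by rewrite leq_pexp2l //; lia.
have -> : (k.+2 * T = k.+1 * T + T)%N by lia.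
rewrite natrD mulrDl lerD //.
  by apply: IH => // j hj; apply: hyp; lia.
apply: (@le_trans _ _ (\sum_(T ^ (2 * k.+1 - 1) <= p < T ^ (2 * k.+2 - 1))
                         u (T ^ (2 * k.+1 - 1)).-1)).
  by apply: ler_sum_nat => p hp; apply: anti; lia.
rewrite sumr_const_nat -[leLHS]mulr_natl.
apply: (@le_trans _ _ ((T ^ (2 * k.+2 - 1))%:R * u (T ^ (2 * k.+1 - 1)).-1)).
  by rewrite ler_wpM2r // ler_nat leq_subr.
have -> : (2 * k.+2 - 1 = 2 * k.+1 + 1)%N by lia.
rewrite expnD expn1 mulnC natrM -mulrA ler_wpM2l //.
by apply: hyp; lia.
Qed.

(* Positions in [l] are counted from [0], so [j = 0] probes the top good. *)
Definition probes {m : nat} (T k : nat) (t : 'I_m) (l : seq 'I_m) : seq 'I_m :=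
  [seq nth t l (T ^ (2 * j - 1)).-1 | j <- iota 0 k].

(** A probe past the end of the list falls back on the top good, which would pass the comparison
    trivially; the length test rules this out. *)
Definition patient {R : realType} (T k len : nat) (ans : seq R) : bool :=
  has (fun j => (T ^ (2 * j - 1) <= len)%N &&
                (ans`_0 <= (T ^ (2 * j))%:R * ans`_j)) (iota 1 k.-1).

(** Agents in [s] are still to be asked, those in [F] wait, and [own] matters only for goods outside
    [S]. Recording owners makes the bundles disjoint and covering by construction. *)
Fixpoint serve {R : realType} {n m : nat} (T k : nat) (rk : rankings n m)
    (i0 : 'I_n) (s F : seq 'I_n) (S : {set 'I_m}) (own : 'I_m -> 'I_n) :
    strategy R n m :=
  if s is i :: s' then
    if by_rank (rk i) S is t :: l then
      ask i (probes T k t (t :: l)) (fun ans =>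
        if patient T k (size (t :: l)) ans
        then serve T k rk i0 s' (i :: F) S own
        else serve T k rk i0 s' F (S :\ t)
               (fun g => if g == t then i else own g))
    else serve T k rk i0 s' (i :: F) S own
  else Output R (fun i => [set g | (if g \in S
         then round_robin rk i0 #|S| (i0 :: F) S g else own g) == i]).

Lemma run_serve_allocation {R : realType} {n m : nat} (T k : nat)
    (rk : rankings n m) (i0 : 'I_n) (v : valuations R n m) s F S own :
  is_allocation (run v (serve T k rk i0 s F S own)).
Proof.
elim: s F S own => [|i s IH] F S own /=.
  split=> [i j ij|].
    rewrite -setI_eq0; apply/eqP/setP => g; rewrite !inE.
    by apply/negbTE/negP => /andP[/eqP -> /eqP ji]; rewrite ji eqxx in ij.
  apply/setP => g; rewrite inE; apply/bigcupP.
  exists (if g \in S then round_robin rk i0 #|S| (i0 :: F) S g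
          else own g) => //.
  by rewrite inE eqxx.
case: (by_rank _ _) => [//|t l]; rewrite run_ask; by case: ifP.
Qed.

Lemma num_queries_serve {R : realType} {n m : nat} (T k : nat)
    (rk : rankings n m) (i0 : 'I_n) (v : valuations R n m) s F S own a :
  (num_queries v (serve T k rk i0 s F S own) a <= count_mem a s * k)%N.
Proof.
elim: s F S own => [|i s IH] F S own //=.
case: (by_rank _ _) => [|t l].
  by apply: leq_trans (IH _ _ _) _; rewrite leq_mul2r leq_addl orbT.
rewrite num_queries_ask size_map size_iota mulnDl leq_add2l.
by case: ifP.
Qed.

(** * Fairness of the outcome *)

Definition tolerant {R : realType} {m : nat} (T : nat) (w : 'I_m -> R)
    (S : {set 'I_m}) (b : nat) : Prop :=
  forall D : {set 'I_m}, (#|D| <= b)%N -> forall g, g \in S ->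
    w g <= (2 * T)%:R * \sum_(h in S :\: D) w h.

(** Let [h] be the good ranked N = T^(2j-1) in the successful test. At least N - b >= N/2 of the
    first N goods survive the loss, each worth at least [h], and the top good is worth at most T N
    times [h]. *)
Lemma patient_tolerant {R : realType} {m : nat} (r : rel 'I_m) (w : 'I_m -> R)
    (S : {set 'I_m}) (t : 'I_m) (l : seq 'I_m) (T k b : nat) :
  strict_linear_order r -> consistent r w -> (forall g, 0 <= w g) ->
  by_rank r S = t :: l -> (2 * b <= T)%N -> (0 < T)%N ->
  patient T k (size (t :: l)) [seq w g | g <- probes T k t (t :: l)] ->
  tolerant T w S b.
Proof.
move=> lin cons w0 eqS bT T0 /hasP[j]; rewrite mem_iota => hj /andP[sz].
have jk : (j < k)%N by lia.
have szp : size (probes T k t (t :: l)) = k by rewrite size_map size_iota.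
rewrite (nth_map t) ?szp; last by lia.
rewrite (nth_map t) ?szp //.
rewrite /probes !(nth_map 0%N) ?size_iota // ?nth_iota //; try lia.
rewrite !add0n muln0 sub0n expn0 /=.
set N := (T ^ (2 * j - 1))%N in sz *; set h := nth _ _ N.-1 => ht D Db g gS.
have N0 : (0 < N)%N by rewrite expn_gt0 T0.
have bN : (2 * b <= N)%N.
  by apply: leq_trans bT _; rewrite -[X in (X <= _)%N]expn1 leq_pexp2l //; lia.
pose A := [set x in take N (t :: l)].
have cA : #|A| = N.
  rewrite cardsE (card_uniqP _) ?size_takel // take_uniq // -eqS.
  exact: by_rank_uniq.
have AS : A \subset S.
  by apply/subsetP => x; rewrite inE => /mem_take; rewrite -eqS mem_by_rank.
have wA x : x \in A -> w h <= w x.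
  rewrite inE => /(nthP t)[p]; rewrite size_takel // => pN <-.
  rewrite nth_take // /h.
  have pN1 : (p <= N.-1)%N by lia.
  have := values_antitone r w S p N.-1 lin cons w0 pN1; rewrite eqS.
  by rewrite (nth_map t) ?(nth_map t) //; lia.
have lb : (N - b)%:R * w h <= \sum_(x in S :\: D) w x.
  apply: (@le_trans _ _ (\sum_(x in A :\: D) w x)); last first.
    by apply: sum_subset_le => //; exact: setSD.
  apply: (@le_trans _ _ (\sum_(x in A :\: D) w h)); last first.
    by apply: ler_sum => x; rewrite inE => /andP[_ /wA].
  rewrite sumr_const -[leRHS]mulr_natl ler_wpM2r // ler_nat.
  rewrite -cA -(cardsID D A) leq_subLR leq_add2r (leq_trans _ Db) //.
  by rewrite subset_leq_card // subsetIr.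
apply: (le_trans (top_max _ _ _ _ _ lin cons w0 eqS _ gS)).
apply: (le_trans ht).
apply: (@le_trans _ _ ((2 * T)%:R * ((N - b)%:R * w h))).
  2: by rewrite ler_wpM2l.
rewrite mulrA ler_wpM2r // -natrM ler_nat.
have -> : (T ^ (2 * j) = T * N)%N.
  by rewrite -expnS; congr (_ ^ _)%N; lia.
nia.
Qed.

Lemma impatient_ub {R : realType} {m : nat} (r : rel 'I_m) (w : 'I_m -> R)
    (S : {set 'I_m}) (t : 'I_m) (l : seq 'I_m) (T k : nat) :
  strict_linear_order r -> consistent r w -> (forall g, 0 <= w g) ->
  by_rank r S = t :: l -> (0 < T)%N -> (0 < k)%N -> (m <= T ^ (2 * k - 1))%N ->
  ~~ patient T k (size (t :: l)) [seq w g | g <- probes T k t (t :: l)] ->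
  \sum_(g in S) w g <= (k * T)%:R * w t.
Proof.
move=> lin cons w0 eqS T0 k0 mT /hasPn imp.
pose u p := [seq w g | g <- by_rank r S]`_p.
have u0 : u 0%N = w t by rewrite /u eqS.
have szS : size (by_rank r S) = #|S| by rewrite size_sort -cardE.
have Sm : (#|S| <= T ^ (2 * k - 1))%N.
  by apply: leq_trans mT; rewrite -[leqRHS]card_ord max_card.
have uge0 p : 0 <= u p.
  rewrite /u; case: (ltnP p #|S|) => hp.
    by rewrite (nth_map t) ?szS.
  by rewrite nth_default // size_map szS.
rewrite -(sum_by_rank r) -u0.
rewrite (big_nth 0) size_map szS.
apply: (@le_trans _ _ (\sum_(0 <= p < T ^ (2 * k - 1)) u p)).
  rewrite [leRHS](big_cat_nat (n := #|S|)) //= lerDl.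
  exact: sumr_ge0.
apply: antitone_sum_ub => //.
  by move=> p q pq; apply: values_antitone.
move=> j hj.
(* If fewer goods are available, the default value 0 of [u] past the end gives the bound. *)
case: (leqP (T ^ (2 * j - 1)) #|S|) => hS; last first.
  by rewrite [u _]nth_default ?mulr0 // size_map szS; lia.
have Tj : (0 < T ^ (2 * j - 1))%N by rewrite expn_gt0 T0.
have := imp j; rewrite mem_iota.
have -> : (0 < j < 1 + k.-1)%N by lia.
move=> /(_ isT).
have szp : size (probes T k t (t :: l)) = k by rewrite size_map size_iota.
rewrite -eqS szS hS /= (nth_map t) ?eqS ?szp //.
rewrite (nth_map t) ?szp //; last lia.
rewrite /probes !(nth_map 0%N) ?size_iota // ?nth_iota //; try lia.
rewrite !add0n muln0 sub0n expn0 /=.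
rewrite -ltNge => /ltW; rewrite /u eqS /=.
rewrite -[w t :: _]/(map w (t :: l)) (nth_map t) //.
by rewrite -eqS szS; lia.
Qed.

(** An agent that left owns a single good. The loss budget [n + size s] of a waiting agent covers
    one good for each agent still to be asked and at most n goods lost in the round robin. *)
Record serve_inv {R : realType} {n m : nat} (T k : nat) (v : valuations R n m)
    (i0 : 'I_n) (s F : seq 'I_n) (S : {set 'I_m}) (own : 'I_m -> 'I_n) :
    Prop := ServeInv {
  inv_uniq : uniq (i0 :: F ++ s);
  inv_out : forall g, g \notin S -> own g \notin i0 :: F ++ s;
  inv_done : forall i, i \notin i0 :: F ++ s -> exists t : 'I_m,
    [/\ t \notin S, forall g, g \notin S -> (own g == i) = (g == t)
      & \sum_(g in S) v i g <= (k * T)%:R * v i t];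
  inv_tolerant : forall i, i \in F -> tolerant T (v i) S (n + size s)
}.

Lemma tolerant_setD1 {R : realType} {m : nat} (T : nat) (w : 'I_m -> R)
    (S : {set 'I_m}) (t : 'I_m) (b : nat) :
  tolerant T w S b.+1 -> tolerant T w (S :\ t) b.
Proof.
move=> tol D Db g; rewrite !inE => /andP[_ gS]; rewrite setDDl.
by apply: tol => //; rewrite cardsU1; case: (t \in D); lia.
Qed.

Lemma tolerant_leq {R : realType} {m : nat} (T : nat) (w : 'I_m -> R)
    (S : {set 'I_m}) (b c : nat) :
  (b <= c)%N -> tolerant T w S c -> tolerant T w S b.
Proof. by move=> bc tol D Db; apply: tol; exact: leq_trans bc. Qed.

(** A singleton bundle is never envied once its good is removed, and all other bundles lie inside
    [S]; so it is enough that each agent gets a fraction [alpha] of [S]. For a waiting agent, the at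
    most n lost goods are each worth at most 2T times the rest, so [S] is worth at most 2nT + 1
    times the rest, of which the agent gets 1/n. *)
Lemma round_robin_EFX {R : realType} {n m : nat} (T k : nat)
    (rk : rankings n m) (v : valuations R n m) (i0 : 'I_n) F S own
    (alpha : R) :
  is_instance v rk -> serve_inv T k v i0 [::] F S own ->
  0 <= alpha -> alpha * (k * T)%:R <= 1 ->
  alpha * (n * (2 * n * T + 1))%:R <= 1 ->
  is_EFX alpha v (run v (serve T k rk i0 [::] F S own)).
Proof.
move=> inst [uq out done tol] a0 a1 a2 i j ij _ g gX.
rewrite cats0 in uq out done.
pose X l := [set h | (if h \in S
  then round_robin rk i0 #|S| (i0 :: F) S h else own h) == l].
change (is_true (g \in X j)) in gX.
change (alpha * \sum_(h in X j :\ g) v i h <= \sum_(h in X i) v i h).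
have rrF h : round_robin rk i0 #|S| (i0 :: F) S h \in i0 :: F.
  exact: round_robin_in.
have [v0 lin cons] := inst i.
have Xge0 l : 0 <= \sum_(h in X l) v i h by exact: sumr_ge0.
have [jF|jF] := boolP (j \in i0 :: F); last first.
  have [t [tS ownt _]] := done j jF.
  have Xj h : h \in X j -> h = t.
    rewrite inE; case: ifPn => hS; last by rewrite ownt // => /eqP.
    by move=> /eqP rj; move: (rrF h); rewrite rj (negPf jF).
  rewrite big1 ?mulr0 // => h; rewrite inE => /andP[hg hX].
  by move: hg; rewrite inE (Xj _ hX) (Xj _ gX) eqxx.
have Sn : (size (i0 :: F) <= n)%N.
  by rewrite -(card_uniqP uq) -[leqRHS]card_ord max_card.
have XjS : X j \subset S.
  apply/subsetP => h; rewrite inE; case: ifPn => // hS /eqP oj.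
  by move: (out h hS); rewrite oj jF.
suff main : alpha * \sum_(h in S) v i h <= \sum_(h in X i) v i h.
  apply: le_trans main; rewrite ler_wpM2l //.
  by apply: sum_subset_le => //; apply: subset_trans XjS; exact: subsetDl.
have [iF|iF] := boolP (i \in i0 :: F); last first.
  have [t [tS ownt ub]] := done i iF.
  apply: (@le_trans _ _ (v i t)).
    apply: (@le_trans _ _ (alpha * ((k * T)%:R * v i t))).
      by rewrite ler_wpM2l.
    by rewrite mulrA ler_piMl.
  rewrite (big_setD1 t) /= ?lerDl ?sumr_ge0 //.
  by rewrite inE (negPf tS) ownt.
have [D Dc Dle] :=
  round_robin_share rk i0 #|S| (i0 :: F) S i (v i) (leqnn _) uq iF lin cons v0.
have share : \sum_(h in S :\: D) v i h <= n%:R * \sum_(h in X i) v i h.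
  apply: (le_trans Dle); apply: ler_pM; rewrite ?ler_nat ?sumr_ge0 //.
  rewrite [leRHS](bigID (mem S)) /=.
  rewrite (eq_bigl (fun h => (h \in X i) && (h \in S))).
    by rewrite lerDl sumr_ge0.
  by move=> h; rewrite inE; case: (h \in S); rewrite ?andbF ?andbT.
set x := \sum_(h in X i) _ in share *.
have x0 : 0 <= x by exact: Xge0.
suff ub : \sum_(h in S) v i h <= (2 * n * T + 1)%:R * \sum_(h in S :\: D) v i h.
  apply: (@le_trans _ _ (alpha * ((2 * n * T + 1)%:R * (n%:R * x)))).
    rewrite ler_wpM2l //; apply: (le_trans ub); by rewrite ler_wpM2l.
  rewrite !mulrA -[alpha * _ * _]mulrA -natrM [((2 * n * T + 1) * n)%N]mulnC.
  by rewrite ler_piMl.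
(* As [i0] heads the queue, it loses no goods and needs no tolerance. *)
have [iEq|ineq] := eqVneq i i0.
  have -> : D = set0.
    by apply/eqP; rewrite -cards_eq0 -leqn0; move: Dc; rewrite /= iEq eqxx.
  by rewrite setD0 ler_peMl ?sumr_ge0 // -[1]/(1%:R) ler_nat addn1.
have iF' : i \in F by move: iF; rewrite inE (negPf ineq).
have Dn : (#|D| <= n)%N.
  by apply: (leq_trans Dc); apply: leq_trans Sn; rewrite ltnW // index_mem.
have bnd h : h \in S -> v i h <= (2 * T)%:R * \sum_(x in S :\: D) v i x.
  by apply: tol => //; rewrite addn0.
have y0 : 0 <= \sum_(x in S :\: D) v i x by exact: sumr_ge0.
have := sum_setD_ub (v i) S D _ (mulr_ge0 (ler0n _ (2 * T)%N) y0) bnd.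
set y := \sum_(x in S :\: D) _ in y0 *.
move=> /le_trans; apply; rewrite mulrA -natrM natrD mulrDl mul1r lerD2r.
by rewrite ler_wpM2r // ler_nat mulnCA -mulnA leq_mul2l leq_mul2r Dn orbT.
Qed.

Lemma serve_EFX {R : realType} {n m : nat} (T k : nat)
    (rk : rankings n m) (v : valuations R n m) (i0 : 'I_n) s F S own
    (alpha : R) :
  is_instance v rk -> serve_inv T k v i0 s F S own ->
  (0 < k)%N -> (4 * n <= T)%N -> (m <= T ^ (2 * k - 1))%N ->
  0 <= alpha -> alpha * (k * T)%:R <= 1 ->
  alpha * (n * (2 * n * T + 1))%:R <= 1 ->
  is_EFX alpha v (run v (serve T k rk i0 s F S own)).
Proof.
move=> inst inv k0 nT mT a0 a1 a2.
have n0 : (0 < n)%N by exact: leq_ltn_trans (ltn_ord i0).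
elim: s F S own inv => [|i s IH] F S own inv; first exact: round_robin_EFX.
have [v0 lin cons] := inst i.
case: inv => uq out done tol.
have permF : perm_eq (i0 :: F ++ i :: s) (i0 :: (i :: F) ++ s).
  rewrite perm_cons /= -cat1s -[i :: (_ ++ _)]cat1s !catA.
  by rewrite perm_cat2r perm_catC.
(* This keeps the budget [n + size s] below 2n, so that [4 * n <= T] provides the [2 * b <= T] of
   [patient_tolerant]. *)
have szs : ((size s).+1 <= n)%N.
  apply: (@leq_trans #|i0 :: F ++ i :: s|).
    by rewrite (card_uniqP uq) /= size_cat /=; lia.
  by rewrite -[leqRHS]card_ord max_card.
have keep : tolerant T (v i) S (n + size s) ->
    serve_inv T k v i0 s (i :: F) S own.
  move=> toli; split.
  - by rewrite -(perm_uniq permF).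
  - by move=> g gS; rewrite -(perm_mem permF) out.
  - by move=> l; rewrite -(perm_mem permF); exact: done.
  - move=> l; rewrite inE => /orP[/eqP -> //|/tol].
    by apply: tolerant_leq; rewrite leq_add2l /=.
rewrite /=; case eqS: (by_rank _ _) => [|t l].
  apply: IH; apply: keep => D _ g; rewrite -(mem_by_rank (rk i)) eqS //.
rewrite run_ask; case: ifPn => [pat|imp].
  apply: IH; apply: keep.
  by apply: patient_tolerant lin cons v0 eqS _ _ pat; lia.
have tS : t \in S by rewrite -(mem_by_rank (rk i)) eqS inE eqxx.
have sub l' : l' \in i0 :: F ++ s -> l' \in i0 :: F ++ i :: s.
  by rewrite !(inE, mem_cat) => /or3P[] -> //; rewrite ?orbT.
have iout : i \notin i0 :: F ++ s.
  move: uq; rewrite (perm_uniq permF) /= !(inE, mem_cat) !negb_or eq_sym.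
  by move=> /and3P[/and3P[-> _ _] /andP[-> ->]].
apply: IH; split.
- move: uq; rewrite (perm_uniq permF) /= inE negb_or.
  by move=> /andP[/andP[_ ->] /andP[_ ->]].
- move=> g; rewrite !inE negb_and negbK; have [-> //|_ /= gS] := eqVneq g t.
  by apply: contra (out g gS); exact: sub.
- move=> l' l'out.
  have [->|li] := eqVneq l' i.
    exists t; split; first by rewrite !inE eqxx.
      move=> g; rewrite !inE negb_and negbK; have [_|_ /= gS] := eqVneq g t.
        by rewrite eqxx.
      apply/negbTE/eqP => oi; move: (out g gS); rewrite oi.
      by rewrite !(inE, mem_cat) eqxx !orbT.
    apply: le_trans (impatient_ub _ _ _ _ _ _ _ lin cons v0 eqS _ k0 mT imp).
      by apply: sum_subset_le => //; exact: subD1set.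
    by lia.
  have [|t' [t'S own' ub]] := done l'.
    by move: l'out; rewrite !(inE, mem_cat) (negPf li).
  exists t'; split; first by rewrite !inE (negPf t'S) andbF.
    move=> g; rewrite !inE negb_and negbK; have [-> _|_ /= gS] := eqVneq g t.
      rewrite eq_sym (negPf li); apply/esym/negbTE/eqP => tt'.
      by rewrite -tt' tS in t'S.
    exact: own'.
  apply: le_trans ub; apply: sum_subset_le; last exact: subD1set.
  by case: (inst l').
- move=> l' l'F; apply: tolerant_setD1; rewrite -addnS; exact: tol.
Qed.

(** * Impossibility *)

Fixpoint transcript {R : realType} {n m : nat} (v : valuations R n m)
    (s : strategy R n m) : seq ('I_n * 'I_m) :=
  if s is Query i g next then (i, g) :: transcript v (next (v i g)) else [::].

Lemma run_eq_on_transcript {R : realType} {n m : nat} (v v' : valuations R n m)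
    (s : strategy R n m) :
  (forall i g, (i, g) \in transcript v s -> v' i g = v i g) ->
  run v' s = run v s.
Proof.
elim: s => //= i g next IH eqv; rewrite eqv ?inE ?eqxx //; apply: IH.
by move=> j h jh; apply: eqv; rewrite inE jh orbT.
Qed.

Definition queried {R : realType} {n m : nat} (v : valuations R n m)
    (s : strategy R n m) (a : 'I_n) : {set 'I_m} :=
  [set g | (a, g) \in transcript v s].

Lemma card_queried {R : realType} {n m : nat} (v : valuations R n m)
    (s : strategy R n m) (a : 'I_n) :
  (#|queried v s a| <= num_queries v s a)%N.
Proof.
elim: s => [X|i g next IH] /=.
  by rewrite leqn0 cards_eq0; apply/eqP/setP => g; rewrite !inE.
apply: leq_trans (leq_add (leqnn _) (IH _)).
have [<-|ia] := eqVneq i a.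
  apply: leq_trans (_ : (#|g |: queried v (next (v i g)) i| <= _)%N).
    apply: subset_leq_card; apply/subsetP => h; rewrite !inE.
    by rewrite xpair_eqE eqxx.
  by rewrite cardsU1; case: (_ \in _).
apply: subset_leq_card; apply/subsetP => h; rewrite !inE xpair_eqE eq_sym.
by rewrite (negPf ia).
Qed.

(** * The hard instance and its robust allocations *)

Lemma index_order_strict (m : nat) :
  strict_linear_order (fun g h : 'I_m => (g < h)%N).
Proof.
split=> [g|h g l|g h]; [exact: ltnn|exact: ltn_trans|].
by rewrite -neq_ltn.
Qed.

(* [pos n g] is [0] exactly on the first [n - 2] goods. *)
Definition pos (n : nat) {m : nat} (g : 'I_m) : nat := (g.+1 - (n - 2))%N.

Definition hard_value {R : realType} (M : R) (T p : nat) : R :=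
  if p is q.+1 then if q is 0 then 1 else ((T * p)%:R)^-1 else M.

Lemma hard_value_antitone {R : realType} (M : R) (T p q : nat) :
  (0 < T)%N -> 1 <= M -> (p <= q)%N -> hard_value M T q <= hard_value M T p.
Proof.
move=> T0 M1; case: p q => [|[|p]] [|[|q]] // pq.
- rewrite /=; apply: le_trans M1; rewrite invf_le1 ?ltr0n ?ler1n; lia.
- by rewrite /= invf_le1 ?ltr0n ?ler1n; lia.
- by rewrite /= lef_pV2 ?posrE ?ltr0n ?ler_nat ?leq_mul2l ?pq ?orbT //; lia.
Qed.

Lemma hard_value_gt0 {R : realType} (M : R) (T p : nat) :
  (0 < T)%N -> 1 <= M -> 0 < hard_value M T p.
Proof.
move=> T0 M1; case: p => [|[|p]] //=; first exact: lt_le_trans M1.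
by rewrite invr_gt0 ltr0n; lia.
Qed.

Lemma hard_value_le1 {R : realType} (M : R) (T p : nat) :
  (0 < T)%N -> 1 <= M -> (0 < p)%N -> hard_value M T p <= 1.
Proof. by move=> T0 M1 p0; exact: (hard_value_antitone M T 1%N). Qed.

Definition antitone {R : realType} {m : nat} (w : 'I_m -> R) : Prop :=
  forall g h : 'I_m, (g <= h)%N -> w h <= w g.

(* The adversary's answers [v0] force the final allocation to satisfy the EFX
   inequalities of every agent [a] for all valuations [w] that [a] could still
   have, [Q a] being the set of goods at which [a] was queried. *)
Definition robust_EFX {R : realType} {n m : nat} (alpha : R) (v0 : 'I_m -> R)
    (Q : 'I_n -> {set 'I_m}) (X : 'I_n -> {set 'I_m}) : Prop :=
  forall a (w : 'I_m -> R), (forall g, 0 <= w g) -> antitone w ->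
    (forall g, g \in Q a -> w g = v0 g) ->
    forall j, a != j -> forall g, g \in X j ->
    alpha * \sum_(h in X j :\ g) w h <= \sum_(h in X a) w h.

(** Replacing the valuation of [a] alone by [w] changes no answer, so the run follows the same path
    to the same allocation, which must be EFX for [w] too. *)
Lemma run_robust_EFX {R : realType} {n m : nat} (alpha : R) (v0 : 'I_m -> R)
    (A : algorithm R n m) :
  (forall g, 0 <= v0 g) -> antitone v0 -> computes_EFX alpha A ->
  let s := A (fun _ g h => (g < h)%N) in
  robust_EFX alpha v0 (queried (fun=> v0) s) (run (fun=> v0) s).
Proof.
move=> v00 v0anti comp s a w w0 wanti wQ j aj g gX.
pose v i := if i == a then w else v0.
have inst : is_instance v (fun _ g h => (g < h)%N).
  move=> i; split; first by move=> h; rewrite /v; case: ifP.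
    exact: index_order_strict.
  move=> h h' hh'; rewrite /v.
  by case: ifP => _; [apply: wanti|apply: v0anti]; exact: ltnW.
have runE : run v s = run (fun=> v0) s.
  apply: run_eq_on_transcript => i h ih; rewrite /v; case: eqP => // ia.
  by apply: wQ; rewrite inE -ia.
have := comp v _ inst a j aj.
rewrite -/s runE /bundle_value /v eqxx; apply=> //.
by apply/set0Pn; exists g.
Qed.

(** The n - 2 head goods have at most n - 2 owners; together with [a] these are fewer than n
    agents. *)
Lemma exists_agent_without_head {n m : nat} (X : 'I_n -> {set 'I_m})
    (a : 'I_n) :
  (2 <= n)%N -> is_allocation X ->
  exists2 b, a != b & forall g : 'I_m, g \in X b -> (0 < pos n g)%N.
Proof.
move=> n2 [disj cov].
have ex g : exists i, g \in X i.
  have : g \in \bigcup_i X i by rewrite cov inE.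
  by move=> /bigcupP[i _ gX]; exists i.
pose own g := xchoose (ex g).
have ownP g i : g \in X i -> own g = i.
  move=> gi; apply/eqP/negPn/negP => ne; have := disj _ _ ne.
  by move=> /disjointFr/(_ (xchooseP (ex g))); rewrite gi.
pose H := [set g : 'I_m | (g < n - 2)%N].
have cH : (#|H| <= n - 2)%N.
  rewrite cardE -(size_map val) -[leqRHS](size_iota 0); apply: uniq_leq_size.
    by rewrite map_inj_uniq ?enum_uniq //; exact: val_inj.
  by move=> p /mapP[g]; rewrite mem_enum inE mem_iota => gH ->.
have : (#|a |: own @: H| < n)%N.
  have oH : (#|own @: H| <= n - 2)%N := leq_trans (leq_imset_card own H) cH.
  by rewrite cardsU1 (leq_ltn_trans (leq_add (leq_b1 _) oH)) //; lia.
rewrite -[X in (_ < X)%N]card_ord -cardsT => lt.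
have /subsetPn[b _] : ~~ ([set: 'I_n] \subset a |: own @: H).
  by apply: contraTN lt => /subset_leq_card; rewrite -leqNgt.
rewrite !inE negb_or eq_sym => /andP[ab bH]; exists b => // g gb.
rewrite /pos subn_gt0 ltnNge; apply: contra bH => gn.
by rewrite -(ownP _ _ gb) imset_f // inE; lia.
Qed.

Lemma pos_mono {n m : nat} (g h : 'I_m) : (g <= h)%N -> (pos n g <= pos n h)%N.
Proof. by rewrite /pos; lia. Qed.

Lemma pos_inj {n m : nat} (g h : 'I_m) :
  (0 < pos n g)%N -> pos n g = pos n h -> g = h.
Proof. by rewrite /pos => g0 eq_gh; apply: val_inj => /=; lia. Qed.

Lemma card_pos_le {n m : nat} (a b : nat) :
  (#|[set g : 'I_m | a < pos n g <= b]| <= b - a)%N.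
Proof.
rewrite cardE -(size_map (pos n)) -[leqRHS](size_iota a.+1).
apply: uniq_leq_size; last first.
  by move=> p /mapP[g]; rewrite mem_enum inE mem_iota => gH ->; lia.
rewrite map_inj_in_uniq ?enum_uniq // => g h.
by rewrite !mem_enum !inE => /andP[ag _] _; apply: pos_inj; lia.
Qed.

Lemma card_pos_ge {n m : nat} (a b : nat) :
  (b <= m - (n - 2))%N ->
  (b - a <= #|[set g : 'I_m | (a < pos n g <= b)%N]|)%N.
Proof.
move=> bm; rewrite cardE -(size_map (pos n)) -[leqLHS](size_iota a.+1).
apply: uniq_leq_size; first exact: iota_uniq.
move=> p; rewrite mem_iota => pab.
have pm : (p + (n - 2) - 1 < m)%N by lia.
apply/mapP; exists (Ordinal pm).
  by rewrite mem_enum inE /pos /=; lia.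
by rewrite /pos /=; lia.
Qed.

Lemma sum_le_num_goods {R : realType} {m : nat} (w : 'I_m -> R)
    (B : {set 'I_m}) :
  (forall g, g \in B -> w g <= 1) -> \sum_(g in B) w g <= m%:R.
Proof.
move=> wB; apply: (@le_trans _ _ (\sum_(g in B) 1)); first exact: ler_sum.
by rewrite sumr_const ler_nat -[leqRHS]card_ord max_card.
Qed.

(** Otherwise the pivot could be worth [M] to [b]. Removing [g] leaves the pivot with [a], while [b]
    holds only goods worth at most 1, hence at most m in total. *)
Lemma pivot_queried {R : realType} {n m : nat} (M alpha : R) (T : nat)
    (Q X : 'I_n -> {set 'I_m}) (a b : 'I_n) (p g : 'I_m) :
  (0 < T)%N -> 1 <= M -> 0 <= alpha -> m%:R < alpha * M -> is_allocation X ->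
  robust_EFX alpha (fun h => hard_value M T (pos n h)) Q X ->
  pos n p = 1%N -> p \in X a -> g \in X a -> g != p ->
  a != b -> (forall h, h \in X b -> (0 < pos n h)%N) -> p \in Q b.
Proof.
move=> T0 M1 a0 aM [disj _] rob pos1 pa ga gp ab bpos.
apply: contraLR aM => pQ; rewrite -leNgt.
pose w (h : 'I_m) := if (pos n h <= 1)%N then M else hard_value M T (pos n h).
have w0 h : 0 <= w h.
  by rewrite /w; case: ifP => _; [apply: le_trans M1|apply/ltW/hard_value_gt0].
have wanti : antitone w.
  move=> h l /(@pos_mono n) hl; rewrite /w; case: (leqP (pos n l) 1%N) => l1.
    by rewrite (leq_trans hl l1).
  case: ifP => _; last exact: hard_value_antitone.
  by apply: (le_trans _ M1); apply: hard_value_le1 => //; lia.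
have wQ h : h \in Q b -> w h = hard_value M T (pos n h).
  move=> hQ; rewrite /w; case: ifP => // h1.
  case h0 : (pos n h) h1 => [//|[|//]] _.
  by move: pQ; rewrite -(@pos_inj n m h p) ?hQ // ?h0 ?pos1.
have ba : b != a by rewrite eq_sym.
have := rob b w w0 wanti wQ a ba g ga.
move=> /le_trans/(_ (_ : _ <= m%:R)) le.
apply: le_trans (le _); last first.
  apply: sum_le_num_goods => h hb; rewrite /w; case: ifPn => [h1|h1].
    have hp : h = p.
      apply: (@pos_inj n); first exact: bpos.
      by rewrite pos1; apply/eqP; rewrite eqn_leq h1 bpos.
    by move: (disj _ _ ab) => /disjointFr/(_ pa); rewrite -hp hb.
  by apply: hard_value_le1 => //; exact: bpos.
rewrite ler_wpM2l // (big_setD1 p) /=; last by rewrite !inE eq_sym gp.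
by rewrite {1}/w pos1 lerDl sumr_ge0.
Qed.

(** Removing [g] leaves the pivot, worth 1, so [b] must hold value at least [alpha]. With unqueried
    goods as low as possible, charge each good of [b] to the queried goods not ranked above it. A
    queried good at position q >= 2 is worth 1/(Tq) and charged fewer than q times, so each of the k
    queries contributes at most 1/T. *)
Lemma bundle_with_pivot {R : realType} {n m : nat} (M alpha : R) (T k : nat)
    (Q X : 'I_n -> {set 'I_m}) (a b : 'I_n) (p g : 'I_m) :
  (0 < T)%N -> 1 <= M -> 0 <= alpha -> is_allocation X ->
  robust_EFX alpha (fun h => hard_value M T (pos n h)) Q X ->
  pos n p = 1%N -> p \in X a -> g \in X a -> g != p ->
  a != b -> (forall h, h \in X b -> (0 < pos n h)%N) -> p \in Q b ->
  (#|Q b| <= k)%N -> alpha * T%:R <= k%:R.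
Proof.
move=> T0 M1 a0 [disj _] rob pos1 pa ga gp ab bpos pQ Qk.
pose v0 (h : 'I_m) := hard_value M T (pos n h).
have v00 h : 0 < v0 h by exact: hard_value_gt0.
(* [w] is the lowest valuation that is compatible with the answers. *)
pose w (h : 'I_m) := if pos n h == 0%N then M
                     else \big[Order.max/0]_(s in Q b | (h <= s)%N) v0 s.
have w0 h : 0 <= w h.
  rewrite /w; case: ifP => _; first exact: le_trans M1.
  exact: bigmax_ge_id.
have v0M s : v0 s <= M by exact: (hard_value_antitone M T 0%N).
have wanti : antitone w.
  move=> h l hl; rewrite /w; case: (posnP (pos n l)) => [l0|l0].
    by have := @pos_mono n _ _ _ hl; rewrite l0 leqn0 => ->.
  case: ifP => _; first by apply: bigmax_le => //; exact: le_trans M1.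
  apply: bigmax_le => [|s /andP[sQ ls]]; first exact: bigmax_ge_id.
  by apply: le_bigmax_cond; rewrite sQ (leq_trans hl).
have wQ h : h \in Q b -> w h = v0 h.
  move=> hQ; rewrite /w; case: eqP => [h0|_]; first by rewrite /v0 h0.
  apply/eqP; rewrite eq_le; apply/andP; split.
    apply: bigmax_le => [|s /andP[_ hs]]; first exact: ltW.
    by apply: hard_value_antitone => //; exact: pos_mono.
  by apply: le_bigmax_cond; rewrite hQ leqnn.
have ba : b != a by rewrite eq_sym.
have := rob b w w0 wanti wQ a ba g ga.
rewrite (big_setD1 p) /=; last by rewrite !inE eq_sym gp.
rewrite wQ // {1}/v0 pos1 /= => le.
have {le} alphab : alpha <= \sum_(h in X b) w h.
  by apply: le_trans le; rewrite ler_peMr // lerDl sumr_ge0.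
have T0' : (0 : R) < T%:R by rewrite ltr0n.
rewrite -ler_pdivlMr //; apply: (le_trans alphab).
have wb h : h \in X b -> w h <= \sum_(s in Q b | (h <= s)%N) v0 s.
  move=> hb; rewrite /w gtn_eqF ?bpos //; apply: bigmax_le => [|s sP].
    by rewrite sumr_ge0 // => s _; exact: ltW.
  by rewrite (bigD1 s) //= lerDl sumr_ge0 // => l _; exact: ltW.
have b1 h : h \in X b -> (1 < pos n h)%N.
  move=> hb; rewrite ltn_neqAle bpos // andbT; apply/eqP => h1.
  have hp : h = p by apply: (@pos_inj n); [exact: bpos|rewrite -h1].
  by move: (disj _ _ ab) => /disjointFr/(_ pa); rewrite -hp hb.
apply: (@le_trans _ _ (\sum_(h in X b) \sum_(s in Q b | (h <= s)%N) v0 s)).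
  exact: ler_sum.
rewrite (exchange_big_dep (mem (Q b))) /=; last by move=> h s _ /andP[].
apply: (@le_trans _ _ (\sum_(s in Q b) (T%:R)^-1)); last first.
  by rewrite sumr_const -[leLHS]mulr_natl ler_wpM2r ?ler_nat // invr_ge0 ltW.
apply: ler_sum => s sQ; rewrite sumr_const.
set c := #|_|.
have cs : (c <= pos n s - 1)%N.
  apply: leq_trans (card_pos_le (n := n) (m := m) 1 (pos n s)).
  apply: subset_leq_card; apply/subsetP => h; rewrite !inE => /and3P[hb _ hs].
  by rewrite b1 // pos_mono.
rewrite -[leLHS]mulr_natl /v0; case s0: (pos n s) cs => [|[|l]] cs /=.
- have -> : c = 0%N by apply/eqP; rewrite -leqn0; exact: cs.
  by rewrite mulr0n mul0r invr_ge0 ltW.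
- have -> : c = 0%N by apply/eqP; rewrite -leqn0; exact: cs.
  by rewrite mulr0n mul0r invr_ge0 ltW.
have l0 : (0 : R) < l.+2%:R by rewrite ltr0n.
rewrite natrM invfM mulrCA ler_piMr ?invr_ge0 ?ler0n // ler_pdivrMr // mul1r.
by rewrite ler_nat (leq_trans cs) ?leq_subr.
Qed.

(** The value of [s0] will be the ceiling for raised goods, so a query at [s0] itself does not lower
    them and need not be avoided. Without queries from the pivot on, the pivot takes this role. *)
Lemma first_query {n m : nat} (k : nat) (Q : {set 'I_m}) (p : 'I_m) :
  pos n p = 1%N -> (#|Q| <= k)%N -> (0 < k)%N ->
  exists s0 : 'I_m, [/\ (0 < pos n s0)%N,
    forall s, s \in Q -> (0 < pos n s)%N -> (s0 <= s)%N
    & (#|[set s in Q | (0 < pos n s)%N] :\ s0| < k)%N].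
Proof.
move=> pos1 Qk k0; have [P0|[s sP]] := set_0Vmem [set s in Q | (0 < pos n s)%N].
  exists p; split; first by rewrite pos1.
    by move=> s sQ s0; move/setP/(_ s): P0; rewrite !inE sQ s0.
  by rewrite P0 set0D cards0.
have [s0 s0P s0min] :=
  @arg_minnP _ s (mem [set s in Q | (0 < pos n s)%N]) val sP.
have {}s0P : s0 \in [set s in Q | (0 < pos n s)%N] := s0P.
exists s0; split; first by move: s0P; rewrite inE => /andP[].
  move=> l lQ l0; apply: s0min.
  by change (l \in [set s in Q | (0 < pos n s)%N]); rewrite inE lQ.
apply: leq_trans Qk.
have -> : (#|[set s in Q | (0 < pos n s)%N] :\ s0|.+1 =
           #|[set s in Q | (0 < pos n s)%N]|)%N.
  by rewrite [in RHS](cardsD1 s0) s0P.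
by apply: subset_leq_card; apply/subsetP => l; rewrite inE => /andP[].
Qed.

(** Pigeonhole on k disjoint intervals. By truncated subtraction the interval for j = 0 is (1,
    T]. *)
Lemma interval_unhit {m : nat} (f : 'I_m -> nat) (T k : nat) (P : {set 'I_m}) :
  (0 < T)%N -> (#|P| < k)%N ->
  exists2 j, (j < k)%N &
    forall s, s \in P -> ~~ (T ^ (2 * j - 1) < f s <= T ^ (2 * j + 1))%N.
Proof.
move=> T0 Pk.
case: (boolP [exists j : 'I_k, [forall s in P,
    ~~ (T ^ (2 * j - 1) < f s <= T ^ (2 * j + 1))%N]]).
  move=> /existsP[j /forall_inP hj].
  by exists (val j); [exact: ltn_ord|exact: hj].
rewrite negb_exists => /forallP hit; exfalso.
have {}hit (j : 'I_k) : exists s, (s \in P) &&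
    (T ^ (2 * j - 1) < f s <= T ^ (2 * j + 1))%N.
  move: (hit j); rewrite negb_forall_in => /exists_inP[s sP].
  by rewrite negbK => hs; exists s; rewrite sP.
pose c j := xchoose (hit j).
have cP j : (c j \in P) /\ (T ^ (2 * j - 1) < f (c j) <= T ^ (2 * j + 1))%N.
  by have /andP[] := xchooseP (hit j).
have mono (i j : 'I_k) : (i < j)%N -> (f (c i) < f (c j))%N.
  move=> ij; have [_ /andP[_ hi]] := cP i; have [_ /andP[hj _]] := cP j.
  apply: leq_ltn_trans hi (leq_ltn_trans _ hj).
  by rewrite leq_pexp2l //; lia.
have cinj : injective c.
  move=> i j cij; apply: val_inj; have := mono i j; have := mono j i.
  rewrite cij ltnn /=; case: (ltngtP i j) => // _ h1 h2.
    by have := h2 isT.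
  by have := h1 isT.
suff : (k <= #|P|)%N by lia.
rewrite -[leqLHS]card_ord -cardsT -(card_imset _ cinj).
by apply: subset_leq_card; apply/subsetP => s /imsetP[j _ ->]; case: (cP j).
Qed.

Lemma sum_le_sum_bundles {R : realType} {n m : nat} (w : 'I_m -> R)
    (X : 'I_n -> {set 'I_m}) (P : {set 'I_m}) :
  (forall g, 0 <= w g) -> is_allocation X ->
  \sum_(g in P) w g <= \sum_(i < n) \sum_(g in P :&: X i) w g.
Proof.
move=> w0 [_ cov]; rewrite (exchange_big_dep (mem P)) /=; last first.
  by move=> i g _; rewrite inE => /andP[].
apply: ler_sum => g gP.
have : g \in \bigcup_i X i by rewrite cov inE.
move=> /bigcupP[i _ gi]; rewrite (bigD1 i) /= ?inE ?gP //.
by rewrite lerDl sumr_ge0.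
Qed.

(** The owner [a] has value at most q, so the part of any bundle inside the unhit interval [P] is
    worth at most 2q after scaling by [alpha]: q for the goods left by EFX and q for the removed
    one. Yet [P] has at least T^(2j+1)/2 goods, each worth at least q / T^(2j). Summing over n
    bundles gives the bound 4n. *)
Lemma pivot_alone {R : realType} {n m : nat} (M alpha : R) (T k : nat)
    (Q X : 'I_n -> {set 'I_m}) (a : 'I_n) (p : 'I_m) :
  (1 < T)%N -> 1 <= M -> 0 <= alpha -> alpha <= 1 -> is_allocation X ->
  robust_EFX alpha (fun h => hard_value M T (pos n h)) Q X ->
  pos n p = 1%N -> X a = [set p] -> (#|Q a| <= k)%N -> (0 < k)%N ->
  (T ^ (2 * k - 1) <= m - (n - 2))%N -> alpha * T%:R <= (4 * n)%:R.
Proof.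
move=> T1 M1 a0 a1 alloc rob pos1 Xa Qk k0 Tm.
have T0 : (0 < T)%N by exact: ltnW.
pose v0 (h : 'I_m) := hard_value M T (pos n h).
have v00 h : 0 < v0 h by exact: hard_value_gt0.
have [s0 [s00 s0min s0k]] := first_query k (Q a) p pos1 Qk k0.
pose q := v0 s0.
have q0 : 0 < q by exact: v00.
have q1 : q <= 1 by exact: hard_value_le1.
(* [w] is the highest compatible valuation in which the pivot is at most [q]. *)
pose w (h : 'I_m) := if pos n h == 0%N then M else
  \big[Order.min/q]_(s in Q a | (0 < pos n s)%N && (s <= h)%N) v0 s.
have w0 h : 0 <= w h.
  rewrite /w; case: ifP => _; first exact: le_trans M1.
  by apply: le_bigmin => [|s _]; exact: ltW.
have wq h : (0 < pos n h)%N -> w h <= q.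
  by move=> h0; rewrite /w gtn_eqF //; exact: bigmin_le_id.
have wanti : antitone w.
  move=> h l hl; case: (posnP (pos n l)) => [l0|l0].
    by have := @pos_mono n _ _ _ hl; rewrite /w l0 leqn0 => ->.
  rewrite {2}/w; case: ifP => _.
    exact: le_trans (wq l l0) (le_trans q1 M1).
  apply: le_bigmin => [|s /and3P[sQ s1 sh]]; first exact: wq.
  rewrite /w gtn_eqF //; apply: bigmin_le_cond.
  by rewrite sQ s1 (leq_trans sh).
have wQ h : h \in Q a -> w h = v0 h.
  move=> hQ; rewrite /w; case: (posnP (pos n h)) => [h0|h0].
    by rewrite /v0 h0.
  apply/eqP; rewrite eq_le; apply/andP; split.
    by apply: bigmin_le_cond; rewrite hQ h0 leqnn.
  apply: le_bigmin => [|s /and3P[_ _ sh]].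
    by apply: hard_value_antitone => //; apply: pos_mono; exact: s0min.
  by apply: hard_value_antitone => //; exact: pos_mono.
have [j jk unhit] := interval_unhit (pos n) T k _ T0 s0k.
pose P := [set g : 'I_m | (T ^ (2 * j - 1) < pos n g <= T ^ (2 * j + 1))%N].
have eT i : (0 < T ^ i)%N by rewrite expn_gt0 T0.
have Ppos g : g \in P -> (0 < pos n g)%N.
  by rewrite inE => /andP[+ _]; exact: leq_ltn_trans.
have E0 : (0 : R) < (T ^ (2 * j))%:R by rewrite ltr0n.
have wP g : g \in P -> q <= (T ^ (2 * j))%:R * w g.
  move=> gP; rewrite -ler_pdivrMl // /w gtn_eqF ?Ppos //.
  have qle : (T ^ (2 * j))%:R^-1 * q <= q.
    by rewrite (ler_piMl (ltW q0)) // invf_le1 // ler1n.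
  apply: le_bigmin => [//|s /and3P[sQ s1 sg]].
  have [->//|ss0] := eqVneq s s0.
  have := unhit s; rewrite !inE ss0 sQ s1 => /(_ isT).
  have := @pos_mono n _ _ _ sg; move: gP; rewrite inE => /andP[_ gle] sgp.
  rewrite (leq_trans sgp gle) andbT -leqNgt => sle.
  apply: (@le_trans _ _ ((T ^ (2 * j))%:R^-1)).
    by rewrite ler_piMr // invr_ge0 ltW.
  rewrite /v0 /hard_value; case es: (pos n s) s1 sle => [//|[|l]] _ sle.
    by rewrite invf_le1 // ler1n.
  rewrite lef_pV2 ?posrE ?ltr0n ?muln_gt0 ?T0 // ler_nat.
  (* For j = 0 the bound [sle] would put [s] at position at most 1, but here its position is at
     least 2. *)
  have j0 : (0 < j)%N by case: (j) sle => //; rewrite muln0 sub0n expn0.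
  apply: (@leq_trans (T * T ^ (2 * j - 1))%N).
    by rewrite leq_mul2l sle orbT.
  by rewrite -expnS leq_pexp2l //; move: j0; clear; lia.
have share i : alpha * \sum_(g in P :&: X i) w g <= 2 * q.
  have [->|ia] := eqVneq i a.
    rewrite Xa big1 ?mulr0 ?(mulr_ge0 _ (ltW q0)) // => g.
    rewrite !inE => /andP[gP /eqP gp]; move: gP; rewrite gp pos1.
    by have := eT (2 * j - 1)%N; lia.
  have [->|[g gX]] := set_0Vmem (P :&: X i).
    by rewrite big_set0 mulr0 mulr_ge0 // ltW.
  move: gX; rewrite inE => /andP[gP gX].
  have ai : a != i by rewrite eq_sym.
  have := rob a w w0 wanti wQ i ai g gX; rewrite Xa big_set1 => le.
  have wpq : w p <= q by apply: wq; rewrite pos1.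
  have wgq : w g <= q by apply: wq; exact: Ppos.
  have awg : alpha * w g <= q by apply: le_trans wgq; rewrite ler_piMl.
  have sub : \sum_(h in P :&: X i) w h <= w g + \sum_(h in X i :\ g) w h.
    by rewrite -(big_setD1 g) //=; apply: sum_subset_le => //; exact: subsetIr.
  have := ler_wpM2l a0 sub; rewrite mulrDr; lra.
have total : alpha * (#|P|%:R * q) <= (T ^ (2 * j))%:R * (n%:R * (2 * q)).
  apply: (@le_trans _ _ (alpha * ((T ^ (2 * j))%:R * \sum_(g in P) w g))).
    rewrite ler_wpM2l // mulr_sumr mulr_natl -sumr_const.
    exact: ler_sum.
  rewrite mulrCA ler_wpM2l ?ler0n //.
  apply: (@le_trans _ _ (\sum_(i < n) (2 * q))); last first.
    by rewrite sumr_const card_ord [leRHS]mulr_natl.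
  apply: (@le_trans _ _ (alpha * \sum_(i < n) \sum_(g in P :&: X i) w g)).
    by rewrite ler_wpM2l // sum_le_sum_bundles.
  by rewrite mulr_sumr; exact: ler_sum.
have cP : (T ^ (2 * j) * T <= 2 * #|P|)%N.
  have le1 : (T ^ (2 * j + 1) <= m - (n - 2))%N.
    by apply: leq_trans Tm; rewrite leq_pexp2l //; lia.
  apply: (@leq_trans (2 * (T ^ (2 * j + 1) - T ^ (2 * j - 1)))%N); last first.
    by rewrite leq_mul2l; exact: card_pos_ge.
  have step : (2 * T ^ (2 * j - 1) <= T ^ (2 * j + 1))%N.
    apply: (@leq_trans (T ^ (2 * j - 1).+1)%N).
      by rewrite expnS leq_mul2r T1 orbT.
    by rewrite leq_pexp2l //; lia.
  by rewrite -expnSr -addn1; lia.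
have cP' : (T ^ (2 * j))%:R * T%:R <= 2 * #|P|%:R :> R.
  by rewrite -!natrM ler_nat.
rewrite -(ler_pM2l E0) -(ler_pM2r q0).
have h1 : alpha * q * ((T ^ (2 * j))%:R * T%:R) <= alpha * q * (2 * #|P|%:R).
  by rewrite ler_wpM2l // mulr_ge0 // ltW.
rewrite natrM; move: h1 total; lra.
Qed.

Lemma robust_EFX_ub {R : realType} {n m : nat} (M alpha : R) (T k : nat)
    (Q X : 'I_n -> {set 'I_m}) :
  (2 <= n)%N -> (0 < k)%N -> (1 < T)%N -> 1 <= M -> 0 <= alpha -> alpha <= 1 ->
  m%:R < alpha * M -> is_allocation X -> (forall a, #|Q a| <= k)%N ->
  robust_EFX alpha (fun h => hard_value M T (pos n h)) Q X ->
  (T ^ (2 * k - 1) <= m - (n - 2))%N -> alpha * T%:R <= (k + 4 * n)%:R.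
Proof.
move=> n2 k0 T1 M1 a0 a1 aM alloc Qk rob Tm.
have T0 : (0 < T)%N by exact: ltnW.
have pm : (n - 2 < m)%N.
  by move: Tm (expn_gt0 T (2 * k - 1)); rewrite T0 /=; lia.
pose p := Ordinal pm.
have pos1 : pos n p = 1%N by rewrite /pos /=; lia.
have : p \in \bigcup_i X i by case: alloc => _ ->; rewrite inE.
move=> /bigcupP[a _ pa].
have [b ab bpos] := exists_agent_without_head X a n2 alloc.
have [Xp|] := eqVneq (X a) [set p].
  have := pivot_alone _ _ _ _ _ _ a p T1 M1 a0 a1 alloc rob pos1 Xp (Qk a) k0 Tm.
  by move=> /le_trans; apply; rewrite ler_nat leq_addl.
rewrite eqEsubset sub1set pa andbT => /subsetPn[g ga]; rewrite inE => gp.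
have pQ := pivot_queried _ _ _ _ _ a b p g T0 M1 a0 aM alloc rob pos1
  pa ga gp ab bpos.
have := bundle_with_pivot _ _ _ k _ _ a b p g T0 M1 a0 alloc rob pos1
  pa ga gp ab bpos pQ (Qk b).
by move=> /le_trans; apply; rewrite ler_nat leq_addr.
Qed.

(** * From the scale T to the exponent 1/(2k-1) *)

Lemma query_algorithm_exists {R : realType} (n m k T : nat) (alpha : R) :
  (2 <= n)%N -> (0 < k)%N -> (4 * n <= T)%N -> (m <= T ^ (2 * k - 1))%N ->
  0 <= alpha -> alpha * (k * T)%:R <= 1 ->
  alpha * (n * (2 * n * T + 1))%:R <= 1 ->
  exists A : algorithm R n m, is_query_algorithm k A /\ computes_EFX alpha A.
Proof.
move=> n2 k0 nT mT a0 a1 a2; pose i0 : 'I_n := Ordinal (ltnW n2).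
pose s := rem i0 (enum 'I_n).
have perm_s : perm_eq (enum 'I_n) (i0 :: s) by rewrite perm_to_rem // mem_enum.
have uq : uniq (i0 :: s) by rewrite -(perm_uniq perm_s) enum_uniq.
exists (fun rk => serve T k rk i0 s [::] setT (fun=> i0)); split=> v rk inst.
  split; first exact: run_serve_allocation.
  move=> a; apply: (leq_trans (num_queries_serve _ _ _ _ _ _ _ _ _ _)).
  rewrite -[leqRHS]mul1n leq_mul2r count_uniq_mem ?leq_b1 ?orbT //.
  by case/andP: uq.
apply: (serve_EFX _ _ _ _ _ _ _ _ _ _ inst _ k0 nT mT a0 a1 a2); split=> //.
- by move=> g; rewrite inE.
- by move=> i; rewrite -(perm_mem perm_s) mem_enum.
Qed.

Lemma query_algorithm_ub {R : realType} (n m k T : nat) (alpha : R)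
    (A : algorithm R n m) :
  (2 <= n)%N -> (0 < k)%N -> (1 < T)%N -> (T ^ (2 * k - 1) <= m - (n - 2))%N ->
  0 < alpha -> alpha <= 1 -> is_query_algorithm k A -> computes_EFX alpha A ->
  alpha * T%:R <= (k + 4 * n)%:R.
Proof.
move=> n2 k0 T1 Tm a0 a1 qA cA.
have T0 : (0 < T)%N by exact: ltnW.
(* Chosen so that [alpha * M] is m + 1, more than any bundle of goods worth at most 1. *)
pose M : R := m.+1%:R / alpha.
have M1 : 1 <= M by rewrite ler_pdivlMr // mul1r (le_trans a1) // ler1n.
have aM : m%:R < alpha * M by rewrite mulrC divfK ?gt_eqF // ltr_nat.
pose v0 (g : 'I_m) := hard_value M T (pos n g).
have v00 g : 0 <= v0 g by apply/ltW/hard_value_gt0.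
have v0anti : antitone v0.
  by move=> g h gh; apply: hard_value_antitone => //; exact: pos_mono.
have inst : is_instance (fun _ : 'I_n => v0) (fun _ g h => (g < h)%N).
  move=> i; split=> //; first exact: index_order_strict.
  by move=> g h gh; apply: v0anti; exact: ltnW.
have [alloc cnt] := qA _ _ inst.
apply: (robust_EFX_ub M alpha T k _ _ n2 k0 T1 M1 (ltW a0) a1 aM alloc _ _ Tm).
  by move=> a; exact: leq_trans (card_queried _ _ a) (cnt a).
exact: run_robust_EFX.
Qed.

Theorem corollary4p4 (R : realType) (n k : nat) (hn : (2 <= n)%N) (hk : (1 <= k)%N) :
  exists (c C : R) (m0 : nat), 0 < c /\ 0 < C /\
    forall m : nat, (m0 <= m)%N -> (n <= m)%N ->
      (exists A : algorithm R n m,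
         is_query_algorithm k A /\
         computes_EFX (c / m%:R `^ (1 / (2 * k - 1)%N%:R)) A) /\
      (forall alpha : R, 0 <= alpha -> alpha <= 1 ->
         C / m%:R `^ (1 / (2 * k - 1)%N%:R) < alpha ->
         ~ exists A : algorithm R n m,
             is_query_algorithm k A /\ computes_EFX alpha A).
Proof.
have n0 : (0 < n)%N by exact: ltnW.
(* With x = m^(1/(2k-1)), the algorithm uses T <= 2x, and both kT and n(2nT + 1) <= 3n^2 T are at
   most 6n^2 k x. The converse uses x <= 4T, hence the 4 in C. The threshold gives x >= 4n >= 8. *)
exists ((6 * n * n * k)%:R^-1), (4 * (k + 4 * n)%:R), ((4 * n) ^ (2 * k - 1))%N.
split; first by rewrite invr_gt0 ltr0n !muln_gt0 n0.
split; first by rewrite mulr_gt0 // ltr0n; lia.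
move=> m m0 _; set K := (2 * k - 1)%N in m0 *; set x := _ `^ _.
have K0 : (0 < K)%N by rewrite /K; lia.
have x0 : 0 <= x by exact: powR_ge0.
have xK : x ^+ K = m%:R.
  rewrite -powR_mulrn // -powRrM div1r mulVf ?pnatr_eq0 ?gtn_eqF //.
  by rewrite powRr1.
have pow_le (y z : R) : 0 <= y -> 0 <= z -> (y ^+ K <= z ^+ K) = (y <= z).
  by move=> y0 z0; rewrite ler_pXn2r.
have x4n : (4 * n)%:R <= x.
  by rewrite -pow_le // xK -natrX ler_nat.
have x8 : 8 <= x by apply: le_trans x4n; rewrite ler_nat; lia.
have xp : 0 < x by lra.
split.
  pose T := (Num.trunc x).+1.
  have xT : x < T%:R by exact: truncnS_gt.
  have Tx : T%:R <= 2 * x.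
    have := truncn_le x; rewrite x0 /T -natr1 => h; lra.
  have c0 : 0 <= (6 * n * n * k)%:R^-1 / x :> R by rewrite divr_ge0 // invr_ge0.
  have small N : (N * 2 <= 6 * n * n * k)%N ->
      (6 * n * n * k)%:R^-1 / x * (N%:R * T%:R) <= 1 :> R.
    move=> hN.
    have D0 : 0 < (6 * n * n * k)%:R :> R by rewrite ltr0n !muln_gt0 n0.
    rewrite -invfM mulrC ler_pdivrMr ?mulr_gt0 // mul1r.
    apply: (@le_trans _ _ (N%:R * (2 * x))); first by rewrite ler_wpM2l.
    by rewrite mulrA -natrM ler_wpM2r // ler_nat.
  apply: (query_algorithm_exists n m k T).
  - exact: hn.
  - exact: hk.
  - by rewrite -(ler_nat R); exact: le_trans (ltW xT).
  - by rewrite -(ler_nat R) natrX -xK pow_le // ltW.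
  - exact: c0.
  - rewrite [(k * T)%:R]natrM; apply: small.
    rewrite mulnC leq_mul2r; apply/orP; right.
    by have : (0 < n * n)%N by [rewrite muln_gt0 n0]; lia.
  - apply: le_trans (small (3 * n * n)%N _); last first.
      by rewrite -[leqLHS]muln1; apply: leq_mul => //; lia.
    rewrite -natrM; apply: ler_wpM2l => //; rewrite ler_nat.
    have nT0 : (0 < n * T)%N by rewrite muln_gt0 n0.
    have -> : (3 * n * n * T = n * (3 * (n * T)))%N by lia.
    by rewrite -[(2 * n * T)%N]mulnA leq_mul2l; apply/orP; right; lia.
move=> alpha _ a1 Ca [A [qA cA]].
pose T := Num.trunc (x / 2).
have hx : 0 <= x / 2 by lra.
have Tle : T%:R <= x / 2 by rewrite truncn_le.
have Tgt : x / 2 < T%:R + 1 by rewrite natr1; exact: truncnS_gt.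
have T4 : x <= 4 * T%:R by lra.
have T1 : (1 < T)%N by rewrite -(ltr_nat R); lra.
have Tm : (T ^ K <= m - (n - 2))%N.
  (* Taking T near x/2 instead of x leaves half of the goods to spare, which covers the n - 2 head
     goods. *)
  have : (2 * T ^ K <= m)%N.
    rewrite -(ler_nat R) natrM natrX -xK.
    have -> : x ^+ K = 2 ^+ K * (x / 2) ^+ K.
      by rewrite -exprMn mulrC divfK // pnatr_eq0.
    apply: ler_pM => //; first exact: exprn_ge0.
      by rewrite -[leLHS]expr1 ler_weXn2l // ler1n.
    by rewrite pow_le.
  have : (4 * n <= m)%N.
    apply: leq_trans m0; rewrite -[leqLHS]expn1 leq_pexp2l //.
    by rewrite muln_gt0 n0.
  by move: (T ^ K)%N; clear; lia.
have Cx : 0 <= 4 * (k + 4 * n)%:R / x by rewrite divr_ge0 // mulr_ge0.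
have a0 : 0 < alpha by exact: le_lt_trans Ca.
have ub := query_algorithm_ub n m k T alpha A hn hk T1 Tm a0 a1 qA cA.
move: Ca; rewrite ltr_pdivrMr // => Ca.
have := ler_wpM2l (ltW a0) T4; lra.
Qed.
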